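(* Let $P_{\underline m}$ be the maximal parabolic subgroup of $G=GL(n,\mathbb{R})$ associated to a composition $\underline m=(m_1,m_2)$ of $n$ and let $B'$ be the standard Borel subgroup of $GL(n_1,\mathbb{R})\times GL(n_2,\mathbb{R})$, where $(n_1,n_2)$ is a composition of $n$. Denote by $(e_1,\dots,e_{n_1})$ the canonical basis of $\mathbb{R}^{n_1}$ and by $(f_1,\dots,f_{n_2})$ the canonical basis of $\mathbb{R}^{n_2}$. Then any $B'$-orbit of $\mathcal D_{\underline m}\simeq G/P_{\underline m}$ admits a representative given by $$\begin{bmatrix}0&\cdots&0&e_{j_{r+1}}&\cdots&e_{j_s}&e_{j_{s+1}}&\cdots&e_{j_{m_1}}\\ f_{i_1}&\cdots&f_{i_r}&f_{i_{r+1}}&\cdots&f_{i_s}&0&\cdots&0\end{bmatrix}.$$ Such a representative is unique if we assume that - $i_1<\cdots<i_s$; - all indices $j_t$ are different, and $j_{s+1}<\cdots<j_{m_1}$.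
   Context: A composition of $n$ is a finite sequence of positive integers with sum $n$. $P_{\underline m}$ is the group of invertible block upper triangular matrices with diagonal blocks of sizes $m_1,m_2$. $GL(n_1,\mathbb{R})\times GL(n_2,\mathbb{R})$ is embedded block diagonally in $GL(n,\mathbb{R})$ and $B'$ is its subgroup of upper triangular matrices, acting by left multiplication. $\mathcal D_{\underline m}$ is the set of $m_1$-dimensional subspaces of $\mathbb{R}^n=\mathbb{R}^{n_1}\oplus\mathbb{R}^{n_2}$, identified with $G/P_{\underline m}$ and with the quotient of the set of $n\times m_1$ real matrices of rank $m_1$ by the right action of $GL(m_1,\mathbb{R})$. A matrix in square brackets denotes its class in this quotient, i.e. its column span; the upper row of the display consists of vectors in $\mathbb{R}^{n_1}$ and the lower row of vectors in $\mathbb{R}^{n_2}$. In the display, $r$ and $s$ are integers with $0\le r\le s\le m_1$, the indices $i_t$ lie in $\{1,\dots,n_2\}$ and the indices $j_t$ lie in $\{1,\dots,n_1\}$. *)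

(* Defs.v *)
From HB Require Import structures.
From mathcomp Require Import all_boot all_order all_algebra.
From mathcomp Require Import classical_sets reals.

Set Implicit Arguments.
Unset Strict Implicit.
Unset Printing Implicit Defensive.

Import GRing.Theory.
Local Open Scope ring_scope.
Local Open Scope classical_set_scope.

Section Defs.
Variable F : fieldType.

Definition gl_act n (g : 'M[F]_n) (V : {vspace 'cV[F]_n}) : {vspace 'cV[F]_n} :=
  (linfun (mulmx g : 'cV[F]_n -> 'cV[F]_n) @: V)%VS.

Definition grassmannian m n : set {vspace 'cV[F]_n} := [set V | \dim V = m].

Definition colspan m n (M : 'M[F]_(n, m)) : {vspace 'cV[F]_n} :=
  (\sum_(t < m) <[col t M]>)%VS.

(* The block upper triangular subgroup of GL(n) for the composition (m, n - m)
   of n. *)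
Definition parabolic m n : set 'M[F]_n :=
  [set g | g \in unitmx /\ forall k l : 'I_n, (l < m <= k)%N -> g k l = 0].

(* [is_trig_mx] means lower triangular, hence the transpose. *)
Definition upper_borel n : set 'M[F]_n :=
  [set b | (b \in unitmx) && is_trig_mx b^T].

Definition levi_borel n1 n2 : set 'M[F]_(n1 + n2) :=
  [set b | exists b1 b2,
     [/\ @upper_borel n1 b1, @upper_borel n2 b2 & b = block_mx b1 0 0 b2]].

Definition orbit_of n (H : set 'M[F]_n) (V : {vspace 'cV[F]_n}) :
    set {vspace 'cV[F]_n} :=
  [set W | exists2 h, H h & W = gl_act h V].

Definition is_orbit n (H : set 'M[F]_n) (X O : set {vspace 'cV[F]_n}) : Prop :=
  exists2 V, X V & O = orbit_of H V.

(* Indices start at 0: columns t < r are (0, f_(i t)), columns r <= t < s are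
   (e_(j t), f_(i t)) and columns s <= t are (e_(j t), 0).  The values i t for
   s <= t and j t for t < r are not used. *)
Definition display_col n1 n2 m (r s : nat) (i : 'I_m -> 'I_n2)
    (j : 'I_m -> 'I_n1) (t : 'I_m) : 'cV[F]_(n1 + n2) :=
  col_mx (if (r <= t)%N then delta_mx (j t) 0 else 0)
         (if (t < s)%N then delta_mx (i t) 0 else 0).

Definition display_mx n1 n2 m (r s : nat) (i : 'I_m -> 'I_n2)
    (j : 'I_m -> 'I_n1) : 'M[F]_(n1 + n2, m) :=
  \matrix_(k, t) display_col r s i j t k 0.

End Defs.

Definition normalized n1 n2 m (r s : nat) (i : 'I_m -> 'I_n2)
    (j : 'I_m -> 'I_n1) : Prop :=
  [/\ forall t u : 'I_m, (t < u < s)%N -> (i t < i u)%N,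
      forall t u : 'I_m, (r <= t)%N -> (r <= u)%N -> t != u -> j t != j u
    & forall t u : 'I_m, (s <= t < u)%N -> (j t < j u)%N].

(* The identifications of the Grassmannian with a quotient of the matrices of
   rank m and with GL(n) / P. *)
Section Identifications.
Variable F : fieldType.

Lemma memv_colspan m n (M : 'M[F]_(n, m)) (v : 'cV[F]_n) :
  reflect (exists c : 'cV_m, v = M *m c) (v \in colspan M).
Proof.
have mulE (c : 'cV_m) : M *m c = \sum_t c t 0 *: col t M.
  apply/colP => k; rewrite mxE summxE; apply: eq_bigr => t _.
  by rewrite !mxE mulrC.
apply: (iffP memv_sumP) => [[w Mw ->] | [c ->]]; last first.
  exists (fun t => c t 0 *: col t M) => [t _|]; last exact: mulE.
  exact/memvZ/memv_line.
have /fin_all_exists[c wE] (t : 'I_m) : exists a, w t = a *: col t M.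
  exact/vlineP/Mw.
exists (\col_t c t); rewrite mulE; apply: eq_bigr => t _.
by rewrite wE mxE.
Qed.

Lemma colspanP m n p (M : 'M[F]_(n, m)) (N : 'M[F]_(n, p)) :
  reflect (exists D, M = N *m D) (colspan M <= colspan N)%VS.
Proof.
apply: (iffP subvP) => [sMN | [D -> v /memv_colspan[c ->]]]; last first.
  by apply/memv_colspan; exists (D *m c); rewrite mulmxA.
have /submxP[D eD] : (M^T <= N^T)%MS.
  apply/row_subP => t; have /sMN/memv_colspan[c ec] : col t M \in colspan M.
    by apply: (subvP (sumv_sup t _ (subvv _))); rewrite ?memv_line.
  by apply/submxP; exists c^T; rewrite -tr_col ec trmx_mul.
by exists D^T; rewrite -[M]trmxK eD trmx_mul trmxK.
Qed.

Definition basis_mx n (V : {vspace 'cV[F]_n}) : 'M[F]_(n, \dim V) :=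
  \matrix_(k < n, t < \dim V) (vbasis V)`_t k 0.

Lemma vbasis_colspan n (V : {vspace 'cV[F]_n}) : V = colspan (basis_mx V).
Proof.
rewrite -{1}(span_basis (vbasisP V)) span_def big_tuple.
apply: eq_bigr => t _; congr (<[_]>)%VS.
by apply/colP => k; rewrite !mxE (tnth_nth 0).
Qed.

Lemma dim_colspan m n (M : 'M[F]_(n, m)) : \dim (colspan M) = \rank M.
Proof.
have dim_le k (N : 'M[F]_(n, k)) : (\dim (colspan N) <= k)%N.
  apply: leq_trans (dimv_leq_sum _ _ _) _.
  rewrite -[leqRHS]card_ord -sum1_card leq_sum // => t _.
  by rewrite dim_vline leq_b1.
apply/eqP; rewrite eqn_leq; apply/andP; split.
  apply: leq_trans (dim_le _ (col_base M)); apply: dimvS.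
  by apply/colspanP; exists (row_base M); rewrite mulmx_base.
have /colspanP[D eD] : (colspan M <= colspan (basis_mx (colspan M)))%VS.
  by rewrite -vbasis_colspan.
have := mxrankM_maxl (basis_mx (colspan M)) D; rewrite -eD => le_rank.
exact: leq_trans le_rank (rank_leq_col _).
Qed.

Lemma gl_act_colspan m n (g : 'M[F]_n) (M : 'M[F]_(n, m)) :
  gl_act g (colspan M) = colspan (g *m M).
Proof.
apply/vspaceP => v; apply/memv_imgP/memv_colspan => [[w] | [c ->]].
  by move=> /memv_colspan[c ->] ->; exists c; rewrite lfunE /= mulmxA.
exists (M *m c); first by apply/memv_colspan; exists c.
by rewrite lfunE /= mulmxA.
Qed.

Lemma grassmannian_colspan m n (V : {vspace 'cV[F]_n}) :
  grassmannian m V <-> exists2 M : 'M[F]_(n, m), \rank M = m & V = colspan M.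
Proof.
split=> [/= dV | [M rM ->]]; last by rewrite /grassmannian /= dim_colspan.
rewrite -dV; exists (basis_mx V); last exact: vbasis_colspan.
by rewrite -dim_colspan -vbasis_colspan.
Qed.

Lemma colspan_eq m n (M N : 'M[F]_(n, m)) : \rank M = m -> \rank N = m ->
  colspan M = colspan N <-> exists2 h, h \in unitmx & N = M *m h.
Proof.
move=> rM rN; split=> [eMN | [h uh ->]].
  have /colspanP[h eh] : (colspan N <= colspan M)%VS by rewrite eMN.
  exists h => //; rewrite -row_full_unit /row_full eqn_leq rank_leq_col /=.
  by rewrite -{1}rN eh mxrankM_maxr.
apply/eqP; rewrite eqEsubv; apply/andP; split; apply/colspanP.
  by exists (invmx h); rewrite mulmxK.
by exists h.
Qed.

Lemma grassmannian_transitive m n (V : {vspace 'cV[F]_n}) : (m <= n)%N ->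
  grassmannian m V <->
  exists2 g, g \in unitmx & V = gl_act g (colspan (pid_mx m : 'M_(n, m))).
Proof.
move=> le_mn; split=> [/grassmannian_colspan[M rM ->] | [g ug ->]]; last first.
  apply/grassmannian_colspan; exists (g *m pid_mx m).
    by rewrite eqmxMfull ?row_full_unit // rank_pid_mx.
  exact: gl_act_colspan.
pose U : 'M[F]_(m, n) := pid_mx m; pose f : 'M_n := pid_mx m *m M^T.
have Uf : U *m f = M^T by rewrite /U /f mulmxA pid_mx_id // pid_mx_1 mul1mx.
have [|g ug Ug] := @complete_unitmx _ _ _ U f.
  by rewrite Uf mxrank_tr rM rank_pid_mx.
exists g^T; first by rewrite unitmx_tr.
by rewrite gl_act_colspan -[pid_mx m]trmxK tr_pid_mx -trmx_mul -Ug Uf trmxK.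
Qed.

Lemma grassmannian_stabilizer m n (g g' : 'M[F]_n) : (m <= n)%N ->
  g \in unitmx -> g' \in unitmx ->
  gl_act g (colspan (pid_mx m : 'M_(n, m)))
    = gl_act g' (colspan (pid_mx m : 'M_(n, m)))
  <-> parabolic m (invmx g *m g').
Proof.
move=> le_mn ug ug'; set p := pid_mx m.
have rp : \rank p = m by rewrite rank_pid_mx.
have rg h : h \in unitmx -> \rank (h *m p) = m.
  by move=> uh; rewrite eqmxMfull ?row_full_unit.
have uq : invmx g *m g' \in unitmx by rewrite unitmx_mul unitmx_inv ug.
have -> : gl_act g (colspan p) = gl_act g' (colspan p) <->
    (colspan ((invmx g *m g') *m p) <= colspan p)%VS.
  rewrite !gl_act_colspan; split=> [e | /colspanP[D eD]].
    have /colspanP[D eD] : (colspan (g' *m p) <= colspan (g *m p))%VS.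
      by rewrite e.
    by apply/colspanP; exists D; rewrite -mulmxA eD -mulmxA mulKmx.
  apply/esym/eqP; rewrite eqEdim !dim_colspan !rg // leqnn andbT.
  apply/colspanP; exists D.
  by rewrite -mulmxA -eD -mulmxA mulKVmx.
set q := invmx g *m g' in uq *.
have pE k t : p k t = (k == t :> nat)%:R.
  by rewrite mxE; case: eqP => // ->; rewrite ltn_ord.
have qpE k t : (q *m p) k t = q k (widen_ord le_mn t).
  rewrite mxE (bigD1 (widen_ord le_mn t)) //= pE eqxx mulr1 big1 ?addr0 //.
  by move=> l ne; rewrite pE (negPf (ne : val l != val t)) mulr0.
have pD0 (D : 'M_m) (k : 'I_n) t : (m <= k)%N -> (p *m D) k t = 0.
  move=> le_mk; rewrite mxE big1 // => l _.
  by rewrite pE gtn_eqF ?mul0r // (leq_trans (ltn_ord l)).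
split=> [/colspanP[D eD] | [_ q0]].
  split=> // k l /andP[lt_lm le_mk].
  have := pD0 D k (Ordinal lt_lm) le_mk; rewrite -eD qpE => <-.
  by congr (q _ _); apply: val_inj.
pose D := \matrix_(k, t < m) q (widen_ord le_mn k) (widen_ord le_mn t).
apply/colspanP; exists D; apply/matrixP => k t; rewrite qpE.
have [le_mk | lt_km] := leqP m k.
  by rewrite pD0 // q0 //= ltn_ord.
rewrite [RHS]mxE (bigD1 (Ordinal lt_km)) //= pE eqxx mul1r big1 ?addr0.
  by rewrite [RHS]mxE; congr (q _ _); apply: val_inj.
move=> l ne; rewrite pE eq_sym.
by rewrite (negPf (ne : val l != val k)) mul0r.
Qed.

End Identifications.

(* Main.v *)
Require Import Defs.
From mathcomp Require Import all_boot all_order all_algebra.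
From mathcomp Require Import classical_sets reals.

Import GRing.Theory.
Local Open Scope ring_scope.
Local Open Scope classical_set_scope.

(* Existence: measure a column by the positions of the last nonzero entries
   (leads) of its upper part in R^n1 and its lower part in R^n2.  Column
   operations minimizing the sum of all leads make the nonzero leads distinct in
   either part; the columns of each part then extend to an invertible upper
   triangular matrix, whose inverse turns them into distinct basis vectors, and
   sorting the columns gives the display.

   Uniqueness: the rank of a matrix after erasing the first a rows of its upper
   part and the first c rows of its lower part depends only on the B'-orbit of
   its column span.  For a display these ranks count the columns with indices
   j_t <= a and i_t <= c (an absent index counting as 0), hence determine the
   set of pairs (j_t, i_t), and the normalization fixes their order. *)

(** * Sorting columns and locating block boundaries *)

Lemma exists_sorting {m} (f : 'I_m -> nat) :
  exists2 sigma : 'I_m -> 'I_m, injective sigma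
    & forall t u : 'I_m, (t <= u)%N -> (f (sigma t) <= f (sigma u))%N.
Proof.
pose le_f := relpre f leq; pose s := sort le_f (enum 'I_m).
have sz : size s = m by rewrite size_sort size_enum_ord.
have s_sorted : sorted le_f s.
  by apply: sort_sorted => t u; apply: leq_total.
exists (fun t => nth t s t) => [t u | t u le_tu].
  rewrite (set_nth_default t u) ?sz // => /eqP.
  by rewrite nth_uniq ?sz ?sort_uniq ?enum_uniq // => /eqP/val_inj.
rewrite (set_nth_default t u) ?sz //.
apply: (sorted_leq_nth _ _ t s_sorted) => //; rewrite ?inE ?sz //.
- by move=> x y z; apply: leq_trans.
- by move=> x; rewrite /= leqnn.
Qed.

(** For nondecreasing [g] this is the length of the initial segment where [g] stays below [c]; the
    bounds [r] and [s] of the display arise this way. *)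
Definition threshold {m} (g : 'I_m -> nat) (c : nat) : nat :=
  \max_(t < m | (g t < c)%N) t.+1.

Lemma threshold_le {m} (g : 'I_m -> nat) (c : nat) : (threshold g c <= m)%N.
Proof. by apply/bigmax_leqP => t _; apply: ltn_ord. Qed.

Lemma leq_threshold {m} (g : 'I_m -> nat) (c d : nat) :
  (c <= d)%N -> (threshold g c <= threshold g d)%N.
Proof.
move=> le_cd; apply/bigmax_leqP => t lt_tc.
by apply: (leq_bigmax_cond t); apply: leq_trans le_cd.
Qed.

Lemma ltn_threshold {m} (g : 'I_m -> nat) (c : nat) (t : 'I_m) :
  (forall t u : 'I_m, (t <= u)%N -> (g t <= g u)%N) ->
  (t < threshold g c)%N = (g t < c)%N.
Proof.
move=> homo_g; apply/idP/idP => [|lt_tc]; last first.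
  exact: (leq_bigmax_cond t).
apply: contraTT; rewrite -!leqNgt => le_ct; apply/bigmax_leqP => u lt_uc.
rewrite ltnNge; apply: contraL lt_uc => /homo_g.
by rewrite -leqNgt; apply: leq_trans.
Qed.

(** * Column operations that separate the leads *)

Section Reduction.
Variable F : fieldType.

(* The index, counted from 1, of the last nonzero entry of column t, and 0 for
   a zero column. *)
Definition lead {n m} (A : 'M[F]_(n, m)) (t : 'I_m) : nat :=
  \max_(k < n | A k t != 0) k.+1.

Lemma lead_leP {n m} (A : 'M[F]_(n, m)) (t : 'I_m) (a : nat) :
  reflect (forall k : 'I_n, (a <= k)%N -> A k t = 0) (lead A t <= a)%N.
Proof.
apply: (iffP (bigmax_leqP _ _ _)) => [le_a k le_ak | A0 k nzA].
  by apply: contraTeq le_ak => /le_a; rewrite -ltnNge.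
by rewrite ltnNge; apply: contra nzA => /A0 ->.
Qed.

Lemma leadS {n m} {A : 'M[F]_(n, m)} {t : 'I_m} {a : nat} : lead A t = a.+1 ->
  exists2 k : 'I_n, k = a :> nat & A k t != 0.
Proof.
move=> lA; have lt_an : (a < n)%N.
  by rewrite -lA; apply/bigmax_leqP => k _; apply: ltn_ord.
exists (Ordinal lt_an) => //; apply/eqP => Aat.
suff: (lead A t <= a)%N by rewrite lA ltnn.
apply/lead_leP => k; rewrite leq_eqVlt => /predU1P[eak | lt_ak].
  by rewrite -Aat; congr (A _ t); apply: val_inj.
by move: k lt_ak; apply/lead_leP; rewrite lA.
Qed.

Lemma lead_le {n m} (A : 'M[F]_(n, m)) (t : 'I_m) : (lead A t <= n)%N.
Proof. by apply/lead_leP => k; rewrite leqNgt ltn_ord. Qed.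

Definition distinct_leads {n m} (A : 'M[F]_(n, m)) : bool :=
  [forall t, forall u,
     (t != u) ==> (lead A t == lead A u) ==> (lead A t == 0%N)].

Lemma distinct_leadsP {n m} {A : 'M[F]_(n, m)} {t u : 'I_m} :
  distinct_leads A -> lead A t = lead A u -> (0 < lead A t)%N -> t = u.
Proof.
move=> /forallP/(_ t)/forallP/(_ u) dA etu; move: dA; rewrite etu eqxx lt0n.
by case: eqP => //= _ ->.
Qed.

Definition transvection {m} (c : F) (t u : 'I_m) : 'M[F]_m :=
  1%:M - c *: delta_mx t u.

Lemma transvection_unit {m} (c : F) (t u : 'I_m) :
  t != u -> transvection c t u \in unitmx.
Proof.
move=> ne_tu.
suff /mulmx1_unit[] : transvection c t u *m transvection (- c) t u = 1%:M by [].
rewrite /transvection mulmxBl mul1mx scaleNr opprK mulmxDr mulmx1.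
rewrite -scalemxAl -scalemxAr mul_delta_mx_0 1?eq_sym // !scaler0 addr0.
by rewrite addrK.
Qed.

Lemma mul_transvection {n m} (A : 'M[F]_(n, m)) (c : F) (t u : 'I_m) k v :
  (A *m transvection c t u) k v = A k v - (v == u)%:R * (c * A k t).
Proof.
rewrite mulmxBr mulmx1 -scalemxAr 3!mxE; congr (_ + _); congr (- _).
rewrite mxE (bigD1 t) //= mxE eqxx /= big1 ?addr0; last first.
  by move=> l /negPf ne; rewrite mxE ne mulr0.
by rewrite mulrCA mulrA mulrC [A k t * c]mulrC mulrA.
Qed.

Lemma lead_transvection_neq {n m} (A : 'M[F]_(n, m)) c (t u v : 'I_m) :
  v != u -> lead (A *m transvection c t u) v = lead A v.
Proof.
move=> /negPf ne; apply: eq_bigl => k.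
by rewrite mul_transvection ne mul0r subr0.
Qed.

Lemma lead_transvection_le {n m} (A : 'M[F]_(n, m)) c (t u : 'I_m) :
  (lead A t <= lead A u)%N -> (lead (A *m transvection c t u) u <= lead A u)%N.
Proof.
move=> le_tu; apply/lead_leP => k le_uk; rewrite mul_transvection eqxx mul1r.
rewrite (lead_leP A u _ (leqnn _)) // (lead_leP A t _ (leqnn _)).
  by rewrite mulr0 subr0.
exact: leq_trans le_uk.
Qed.

Lemma lead_transvection_lt {n m} (A : 'M[F]_(n, m)) (t u : 'I_m) :
  lead A t = lead A u -> (0 < lead A t)%N ->
  exists c, (lead (A *m transvection c t u) u < lead A u)%N.
Proof.
case lAt: (lead A t) => [//|a] lAu _; have [k eka nzA] := leadS lAt.
(* The quotient of the two leading entries: it cancels the entry of column [u] at the common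
   lead. *)
exists (A k u / A k t); rewrite -lAu ltnS; apply/lead_leP => l.
rewrite mul_transvection eqxx mul1r leq_eqVlt => /predU1P[eal | lt_al].
  have -> : l = k by apply: val_inj; rewrite /= eka.
  by rewrite divfK ?subrr.
move: (lt_al); rewrite {1}lAu => /(lead_leP _ _ _ (leqnn _)) ->.
rewrite -lAt in lt_al.
by rewrite (lead_leP _ _ _ (leqnn _) l lt_al) mulr0 subr0.
Qed.

Definition weight {n1 n2 m} (A : 'M[F]_(n1, m)) (C : 'M[F]_(n2, m)) : nat :=
  \sum_(t < m) (lead A t + lead C t).

Lemma weightC {n1 n2 m} (A : 'M[F]_(n1, m)) (C : 'M[F]_(n2, m)) :
  weight A C = weight C A.
Proof. by apply: eq_bigr => t _; rewrite addnC. Qed.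

(* If two columns have the same lead in A, subtract a multiple of the one with
   the smaller lead in C from the other one. *)
Lemma weight_decreases {n1 n2 m} (A : 'M[F]_(n1, m)) (C : 'M[F]_(n2, m)) :
  ~~ distinct_leads A ->
  exists2 h, h \in unitmx & (weight (A *m h) (C *m h) < weight A C)%N.
Proof.
rewrite negb_forall => /existsP[t]; rewrite negb_forall => /existsP[u].
rewrite !negb_imply -lt0n => /and3P[ne_tu /eqP eAtu Atgt0].
wlog leC : t u ne_tu eAtu Atgt0 / (lead C t <= lead C u)%N.
  move=> IH; have [/IH|/ltnW/IH] := leqP (lead C t) (lead C u); first exact.
  by apply; rewrite 1?eq_sym -?eAtu.
have [c lt_c] := lead_transvection_lt A t u eAtu Atgt0.
exists (transvection c t u); first exact: transvection_unit.
rewrite /weight (bigD1 u) //= [ltnRHS](bigD1 u) //= -addSn leq_add //.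
  by rewrite -addSn leq_add // lead_transvection_le.
by rewrite leq_sum // => v ne_vu; rewrite !lead_transvection_neq.
Qed.

(** Induction on the weight: while leads collide in either part, a column operation applied to both
    parts at once lowers it. *)
Lemma exists_distinct_leads {n1 n2 m} (A : 'M[F]_(n1, m)) (C : 'M[F]_(n2, m)) :
  exists2 h, h \in unitmx & distinct_leads (A *m h) && distinct_leads (C *m h).
Proof.
have [w] := ubnP (weight A C); elim: w A C => // w IH A C lt_w.
have [dAC | ] := boolP (distinct_leads A && distinct_leads C).
  by exists 1%:M; rewrite ?unitmx1 ?mulmx1.
have recur h : h \in unitmx -> (weight (A *m h) (C *m h) < weight A C)%N ->
    exists2 h, h \in unitmx &
      distinct_leads (A *m h) && distinct_leads (C *m h).
  move=> uh /leq_trans/(_ lt_w)/IH[h' uh' dh].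
  by exists (h *m h'); rewrite ?unitmx_mul ?uh // !mulmxA.
rewrite negb_and => /orP[nA | nC].
  by have [h uh lt_h] := weight_decreases A C nA; apply: recur lt_h.
have [h uh lt_h] := weight_decreases C A nC; apply: recur uh _.
by rewrite weightC (weightC A).
Qed.

(** * Straightening the columns by the upper triangular group *)

Definition lead_mx {n m} (A : 'M[F]_(n, m)) : 'M[F]_(n, m) :=
  \matrix_(k, t) (lead A t == k.+1)%:R.

(** Column [l] of [b] is the column of [A] with lead [l.+1], if there is one, and the standard basis
    vector otherwise. In both cases its last nonzero entry is on the diagonal, so [b] is upper
    triangular and invertible. *)
Lemma distinct_leads_factor {n m} (A : 'M[F]_(n, m)) : distinct_leads A ->
  exists2 b, upper_borel b & A = b *m lead_mx A.
Proof.
move=> dA; pose b : 'M[F]_n := \matrix_(k, l)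
  if [pick t | lead A t == l.+1] is Some t then A k t else (k == l)%:R.
have bP (k l : 'I_n) t : lead A t = l.+1 -> b k l = A k t.
  move=> lA; rewrite mxE; case: pickP => [u /eqP lAu | /(_ t) /=]; last first.
    by rewrite lA eqxx.
  by rewrite (distinct_leadsP dA (_ : lead A u = lead A t)) ?lAu ?lA.
exists b; last first.
  apply/matrixP => k t; rewrite mxE; case lA: (lead A t) => [|a].
    rewrite big1 => [|l _]; last by rewrite [lead_mx _ _ _]mxE lA mulr0.
    by apply: (lead_leP A t 0 _); rewrite ?lA.
  have [l ela nzA] := leadS lA.
  rewrite (bigD1 l) //= [lead_mx _ _ _]mxE lA ela eqxx mulr1.
  rewrite (bP _ _ t) ?ela // big1 ?addr0 // => l' ne.
  rewrite [lead_mx _ _ _]mxE lA eqSS -ela.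
  by rewrite eq_sym (negPf (ne : val l' != val l)) mulr0.
have b_tr : is_trig_mx b^T.
  apply/is_trig_mxP => l k lt_lk; rewrite mxE.
  rewrite mxE; case: pickP => [t /eqP lA | _].
    by apply: (lead_leP A t _ _); first rewrite lA; last exact: lt_lk.
  by rewrite -val_eqE gtn_eqF.
rewrite /upper_borel /= b_tr andbT -unitmx_tr unitmxE det_trig // unitfE.
apply/prodf_neq0 => l _; rewrite !mxE; case: pickP => [t /eqP lA | _].
  have [k ekl nzA] := leadS lA.
  by rewrite (_ : l = k) //; apply: val_inj; rewrite /= ekl.
by rewrite eqxx oner_neq0.
Qed.

Lemma upper_borel_inv {n} (b : 'M[F]_n) :
  upper_borel b -> upper_borel (invmx b).
Proof.
rewrite /upper_borel /= => /andP[ub tb]; rewrite unitmx_inv ub /=.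
have nzb l : b l l != 0.
  have : \det b^T != 0 by rewrite -unitfE -unitmxE unitmx_tr.
  by rewrite det_trig // => /prodf_neq0/(_ l isT); rewrite mxE.
have b0 (k l : 'I_n) : (l < k)%N -> b k l = 0.
  by move=> lt_lk; have /is_trig_mxP/(_ _ _ lt_lk) := tb; rewrite mxE.
apply/is_trig_mxP => l k; rewrite [_^T l k]mxE.
(* Strong induction on the column [l]: in the entry [(k, l)] of [invmx b *m b], terms with [p > l]
   vanish because [b] is triangular and terms with [p < l] by induction, leaving a multiple of
   [b l l], which is nonzero. *)
have [a] := ubnP l; elim: a l => // a IH l lt_la lt_lk.
have /matrixP/(_ k l) := mulVmx ub; rewrite !mxE -val_eqE gtn_eqF //.
rewrite (bigD1 l) //= big1 ?addr0 => [/eqP|p ne].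
  by rewrite mulf_eq0 (negPf (nzb l)) orbF => /eqP.
have [lt_lp | le_pl] := ltnP l p; first by rewrite b0 ?mulr0.
have lt_pl : (p < l)%N by rewrite ltn_neqAle ne.
by rewrite IH ?mul0r //; [apply: leq_trans lt_pl _ | apply: ltn_trans lt_lk].
Qed.

Lemma levi_borel_inv {n1 n2} (b : 'M[F]_(n1 + n2)) :
  levi_borel b -> b \in unitmx /\ levi_borel (invmx b).
Proof.
case=> [b1 [b2 [ub1 ub2 ->]]].
have ub : block_mx b1 0 0 b2 \in unitmx.
  by rewrite block_diag_mx_unit; case/andP: ub1 => ->; case/andP: ub2 => ->.
split=> //; exists (invmx b1), (invmx b2).
by split; rewrite ?invmx_block_diag //; apply: upper_borel_inv.
Qed.

Lemma col_neq0 {m n} (M : 'M[F]_(n, m)) (t : 'I_m) :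
  \rank M = m -> col t M != 0.
Proof.
move=> rM; apply/eqP => Mt0; have free : row_free M^T.
  by rewrite /row_free mxrank_tr rM.
have dM : delta_mx 0 t *m M^T = 0 *m M^T :> 'rV_n.
  by rewrite mul0mx -rowE -tr_col Mt0 trmx0.
have /rowP/(_ t)/eqP := row_free_inj free dM.
by rewrite !mxE !eqxx oner_eq0.
Qed.

Lemma colspan_reindex {m n} (M : 'M[F]_(n, m)) (sigma : 'I_m -> 'I_m) :
  injective sigma -> colspan (colsub sigma M) = colspan M.
Proof.
move=> inj; rewrite [RHS](reindex_inj inj); apply: eq_bigr => t _.
by congr <[_]>%VS; apply/colP => k; rewrite !mxE.
Qed.

Lemma levi_borel_reduction {m n1 n2} (V : {vspace 'cV[F]_(n1 + n2)}) :
  grassmannian m V -> exists (A : 'M[F]_(n1, m)) (C : 'M[F]_(n2, m)) b,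
    [/\ levi_borel b, V = gl_act b (colspan (col_mx (lead_mx A) (lead_mx C)))
      & forall t, (0 < lead A t)%N || (0 < lead C t)%N].
Proof.
move=> /grassmannian_colspan[M rM ->].
have [h uh /andP[]] := exists_distinct_leads (usubmx M) (dsubmx M).
set A := _ *m h; set C := _ *m h => dA dC.
have [b1 ub1 eA] := distinct_leads_factor A dA.
have [b2 ub2 eC] := distinct_leads_factor C dC.
have eM : M *m h = col_mx A C by rewrite -mul_col_mx vsubmxK.
have rMh : \rank (M *m h) = m by rewrite mxrankMfree // row_free_unit.
exists A, C, (block_mx b1 0 0 b2); split.
- by exists b1, b2.
- rewrite gl_act_colspan mul_block_col !mul0mx addr0 add0r -eA -eC -eM.
  by apply/(colspan_eq rM rMh); exists h.
(* Full rank excludes a column that is zero in both parts. *)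
move=> t; have := col_neq0 (M *m h) t rMh; rewrite eM !lt0n -negb_and -!leqn0.
apply: contra => /andP[/lead_leP A0 /lead_leP C0].
apply/eqP/colP => k; rewrite mxE [RHS]mxE.
by case: (split_ordP k) => l ->; rewrite ?col_mxEu ?col_mxEd ?A0 ?C0.
Qed.

(** * Arranging the basis vectors into a display *)

Lemma display_mxE {n1 n2 m} r s (i : 'I_m -> 'I_n2) (j : 'I_m -> 'I_n1) :
  display_mx F r s i j =
    col_mx (\matrix_(k, t) ((r <= t)%N && (k == j t))%:R)
           (\matrix_(k, t) ((t < s)%N && (k == i t))%:R).
Proof.
apply/matrixP => k t; rewrite mxE /display_col.
case: (split_ordP k) => l ->; rewrite ?col_mxEu ?col_mxEd !mxE.
  by case: ifP => _; rewrite mxE ?eqxx ?andbT.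
by case: ifP => _; rewrite mxE ?eqxx ?andbT.
Qed.

Lemma display_mx_lead {n1 n2 m} (hn1 : (0 < n1)%N) (hn2 : (0 < n2)%N)
    (A : 'M[F]_(n1, m)) (C : 'M[F]_(n2, m)) :
  (forall t, (0 < lead A t)%N || (0 < lead C t)%N) ->
  exists r s (i : 'I_m -> 'I_n2) (j : 'I_m -> 'I_n1), (r <= s <= m)%N /\
    colspan (display_mx F r s i j) = colspan (col_mx (lead_mx A) (lead_mx C)).
Proof.
(* Blocks 0, 1, 2 hold the columns with only a lower part, with both parts, with only an upper part;
   after sorting by block, the two boundaries are [r] and [s]. *)
move=> nz; pose block t :=
  if lead A t == 0%N then 0%N else if lead C t == 0%N then 2%N else 1%N.
have [sigma inj homo] := exists_sorting block.
pose g t := block (sigma t).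
exists (threshold g 1), (threshold g 2).
(* Leads count from 1, hence the predecessor; an absent vector also gets index 0, at a position that
   the display masks. *)
exists (fun t => insubd (Ordinal hn2) (lead C (sigma t)).-1).
exists (fun t => insubd (Ordinal hn1) (lead A (sigma t)).-1).
split; first by rewrite leq_threshold // threshold_le.
rewrite -[RHS](colspan_reindex _ _ inj) display_mxE; congr colspan.
apply/matrixP => k t; rewrite [RHS]mxE.
have lt_pred n l : (0 < l)%N -> (l <= n)%N -> (l.-1 < n)%N by case: l.
case: (split_ordP k) => l ->; rewrite ?col_mxEu ?col_mxEd !mxE.
  rewrite leqNgt ltn_threshold // /g /block.
  have [-> //|] := eqVneq (lead A (sigma t)) 0%N; rewrite -lt0n => lA.
  rewrite -val_eqE /= insubdK; last exact/lt_pred/lead_le.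
  by case: ifP => _ /=; case: (lead A _) lA => // a _; rewrite eqSS eq_sym.
rewrite ltn_threshold // /g /block.
have := nz (sigma t); case: eqVneq => [->|_] /= => [lC|_]; last first.
  have [-> //|] := eqVneq (lead C (sigma t)) 0%N; rewrite -lt0n => lC.
  rewrite -val_eqE /= insubdK; last exact/lt_pred/lead_le.
  by case: (lead C _) lC => // a _; rewrite eqSS eq_sym.
rewrite -val_eqE /= insubdK; last exact/lt_pred/lead_le.
by case: (lead C _) lC => // a _; rewrite eqSS eq_sym.
Qed.

Lemma gl_act_inv {n} (b : 'M[F]_n) (V : {vspace 'cV[F]_n}) :
  b \in unitmx -> gl_act (invmx b) (gl_act b V) = V.
Proof.
by move=> ub; rewrite (vbasis_colspan V) !gl_act_colspan mulmxA mulVmx ?mul1mx.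
Qed.

Lemma exists_display {m n1 n2} (hn1 : (0 < n1)%N) (hn2 : (0 < n2)%N)
    (V : {vspace 'cV[F]_(n1 + n2)}) : grassmannian m V ->
  exists r s (i : 'I_m -> 'I_n2) (j : 'I_m -> 'I_n1), (r <= s <= m)%N /\
    orbit_of (@levi_borel F n1 n2) V (colspan (display_mx F r s i j)).
Proof.
move=> /levi_borel_reduction[A [C [b [lb -> /(display_mx_lead hn1 hn2)]]]].
move=> [r [s [i [j [le_rs eW]]]]]; exists r, s, i, j; split=> //.
have [ub lb'] := levi_borel_inv b lb.
by exists (invmx b) => //; rewrite gl_act_inv.
Qed.

(** * Ranks constant on orbits, and their values on displays *)

(** Reading a linear relation in the row [k] of a nonzero column kills the coefficient of that
    column, so the nonzero columns are independent. *)
Lemma mxrank_isolated_cols {n m} (M : 'M[F]_(n, m)) :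
  (forall t, col t M != 0 ->
     exists2 k, M k t != 0 & forall u, u != t -> M k u = 0) ->
  \rank M = #|[pred t | col t M != 0]|.
Proof.
move=> pivot; rewrite -dim_colspan.
have /directvP -> /= : directv (\sum_(t < m) <[col t M]>)%VS.
  apply/directv_sum_independent => v Mv sum0 t _.
  have /vlineP[c ec] := Mv t isT.
  have [Mt0 | /pivot[k nzM M0]] := eqVneq (col t M) 0.
    by rewrite ec Mt0 scaler0.
  move/colP/(_ k): sum0; rewrite summxE (bigD1 t) //= big1 => [|u ne_ut].
    move/eqP; rewrite addr0 ec !mxE mulf_eq0 (negPf nzM) orbF => /eqP ->.
    by rewrite scale0r.
  by have /vlineP[d ->] := Mv u isT; rewrite !mxE M0 ?mulr0.
rewrite -sum1_card [RHS]big_mkcond; apply: eq_bigr => t _.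
by rewrite dim_vline inE; case: eqP.
Qed.

Definition lower_proj {n} (a : nat) : 'M[F]_n :=
  diag_mx (\row_(k < n) (a <= k)%N%:R).

Lemma lower_projE {n m} (a : nat) (M : 'M[F]_(n, m)) k t :
  (lower_proj a *m M) k t = (a <= k)%N%:R * M k t.
Proof. by rewrite mul_diag_mx !mxE. Qed.

(** An upper triangular [b] preserves the span of the first [a] basis vectors, so erasing these
    coordinates first does not change the rows kept afterwards. *)
Lemma lower_proj_upper {n} (a : nat) (b : 'M[F]_n) : upper_borel b ->
  lower_proj a *m b *m lower_proj a = lower_proj a *m b.
Proof.
case/andP=> _ /is_trig_mxP b_tr; apply/matrixP => k l.
rewrite mul_mx_diag mxE lower_projE [X in _ * X = _]mxE.
have [le_ak | _] := leqP a k; last by rewrite !mul0r.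
have [le_al | lt_la] := leqP a l; first by rewrite mulr1.
have := b_tr l k (leq_trans lt_la le_ak); rewrite mxE => ->.
by rewrite !mulr0.
Qed.

Definition lower_proj2 {n1 n2} (a c : nat) : 'M[F]_(n1 + n2) :=
  block_mx (lower_proj a) 0 0 (lower_proj c).

Lemma lower_proj2_levi {n1 n2} (a c : nat) (b : 'M[F]_(n1 + n2)) :
  levi_borel b ->
  lower_proj2 a c *m b *m lower_proj2 a c = lower_proj2 a c *m b.
Proof.
case=> b1 [b2 [ub1 ub2 ->]]; rewrite !mulmx_block.
by rewrite !(mulmx0, mul0mx, addr0, add0r) !lower_proj_upper.
Qed.

(** Write [M] as [b *m N *m D] and insert a second projection between [b] and [N]; the outer factors
    cannot raise the rank. *)
Lemma rank_lower_proj2_act {n1 n2 m p} (a c : nat) (b : 'M[F]_(n1 + n2))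
    (M : 'M[F]_(n1 + n2, m)) (N : 'M[F]_(n1 + n2, p)) :
  levi_borel b -> colspan M = gl_act b (colspan N) ->
  (\rank (lower_proj2 a c *m M) <= \rank (lower_proj2 a c *m N))%N.
Proof.
move=> lb eM; have /colspanP[D ->] : (colspan M <= colspan (b *m N))%VS.
  by rewrite eM gl_act_colspan.
rewrite !mulmxA -lower_proj2_levi // -[_ *m N]mulmxA.
exact: leq_trans (mxrankM_maxl _ _) (mxrankM_maxr _ _).
Qed.

Lemma rank_lower_proj2_orbit {n1 n2 m p} (a c : nat)
    (M : 'M[F]_(n1 + n2, m)) (N : 'M[F]_(n1 + n2, p)) :
  orbit_of (@levi_borel F n1 n2) (colspan N) (colspan M) ->
  \rank (lower_proj2 a c *m M) = \rank (lower_proj2 a c *m N).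
Proof.
case=> b lb eM; apply/eqP; rewrite eqn_leq (rank_lower_proj2_act _ _ b) //=.
have [ub lb'] := levi_borel_inv b lb.
by rewrite (rank_lower_proj2_act _ _ _ _ _ lb') // eM gl_act_inv.
Qed.

End Reduction.

(* The indices j_t and i_t counted from 1, and 0 when e_(j_t) resp. f_(i_t)
   is absent from column t. *)
Definition etop {n1 m} (r : nat) (j : 'I_m -> 'I_n1) (t : 'I_m) : nat :=
  if (r <= t)%N then (j t).+1 else 0%N.

Definition ebot {n2 m} (s : nat) (i : 'I_m -> 'I_n2) (t : 'I_m) : nat :=
  if (t < s)%N then (i t).+1 else 0%N.

Lemma normalized_i_inj {n1 n2 m r s} {i : 'I_m -> 'I_n2} {j : 'I_m -> 'I_n1}
    {t u : 'I_m} :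
  normalized r s i j -> (t < s)%N -> (u < s)%N -> i t = i u -> t = u.
Proof.
case=> i_lt _ _ ts us eq_i; apply: val_inj.
have [lt_tu | lt_ut | //] := ltngtP t u.
  by have := i_lt t u; rewrite lt_tu us eq_i ltnn => /(_ isT).
by have := i_lt u t; rewrite lt_ut ts eq_i ltnn => /(_ isT).
Qed.

Lemma rank_lower_proj2_display {F : fieldType} {n1 n2 m r s}
    (i : 'I_m -> 'I_n2) (j : 'I_m -> 'I_n1) (a c : nat) :
  normalized r s i j ->
  \rank (lower_proj2 F a c *m display_mx F r s i j) =
    (m - #|[pred t | (etop r j t <= a)%N && (ebot s i t <= c)%N]|)%N.
Proof.
move=> nrm; rewrite display_mxE mul_block_col !mul0mx addr0 add0r.
set A := _ *m _; set C := _ *m _.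
have AE k t : A k t = [&& (a <= k)%N, (r <= t)%N & k == j t]%:R.
  by rewrite lower_projE mxE -natrM mulnb.
have CE k t : C k t = [&& (c <= k)%N, (t < s)%N & k == i t]%:R.
  by rewrite lower_projE mxE -natrM mulnb.
have A_pivot t : (a < etop r j t)%N -> (r <= t)%N && (a <= j t)%N.
  by rewrite /etop; case: ifP.
have C_pivot t : (c < ebot s i t)%N -> (t < s)%N && (c <= i t)%N.
  by rewrite /ebot; case: ifP.
have pivot t : ~~ ((etop r j t <= a)%N && (ebot s i t <= c)%N) ->
    exists2 k, col_mx A C k t != 0 & forall u, u != t -> col_mx A C k u = 0.
  rewrite negb_and -!ltnNge.
  case/orP=> [/A_pivot/andP[rt aj] | /C_pivot/andP[ts ci]].
    exists (lshift n2 (j t)) => [|u ne_ut].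
      by rewrite col_mxEu AE rt aj eqxx oner_neq0.
    rewrite col_mxEu AE; case: eqP => [eq_j|]; last by rewrite !andbF.
    have [ru|] := boolP (r <= u)%N; last by rewrite andbF.
    case: nrm => _ /(_ u t ru rt ne_ut) + _.
    by rewrite eq_j eqxx.
  exists (rshift n1 (i t)) => [|u ne_ut].
    by rewrite col_mxEd CE ts ci eqxx oner_neq0.
  rewrite col_mxEd CE; case: eqP => [eq_i|]; last by rewrite !andbF.
  have [us|] := boolP (u < s)%N; last by rewrite andbF.
  by rewrite (normalized_i_inj nrm us ts) ?eqxx in ne_ut.
have colE t : (col t (col_mx A C) != 0) =
    ~~ ((etop r j t <= a)%N && (ebot s i t <= c)%N).
  apply/idP/idP => [|/pivot[k nz _]]; last first.
    by apply: contra nz => /eqP/colP/(_ k); rewrite mxE [RHS]mxE => ->.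
  apply: contra => /andP[le_a le_c]; apply/eqP/colP => k.
  rewrite mxE [RHS]mxE; case: (split_ordP k) => l ->.
    rewrite col_mxEu AE; case: and3P => // -[al rt /eqP el].
    by move: le_a; rewrite /etop rt ltnNge -el al.
  rewrite col_mxEd CE; case: and3P => // -[cl ts /eqP el].
  by move: le_c; rewrite /ebot ts ltnNge -el cl.
rewrite mxrank_isolated_cols => [|t]; last by rewrite colE; apply: pivot.
set D := [pred t | _ & _]; rewrite -[LHS](addKn #|D|); congr (_ - _)%N.
rewrite -[RHS]card_ord -(cardC D); congr (_ + _)%N.
by apply: eq_card => t; rewrite !inE colE.
Qed.

Lemma card_eq_of_card_le {m} (x x' : 'I_m -> nat) (Q Q' : pred 'I_m) :
  (forall a, #|[pred t | (x t <= a)%N && Q t]| =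
             #|[pred t | (x' t <= a)%N && Q' t]|) ->
  forall a, #|[pred t | (x t == a) && Q t]| =
            #|[pred t | (x' t == a) && Q' t]|.
Proof.
have split_card (w : 'I_m -> nat) (P : pred 'I_m) a :
    #|[pred t | (w t <= a.+1)%N && P t]| =
    (#|[pred t | (w t <= a)%N && P t]| + #|[pred t | (w t == a.+1) && P t]|)%N.
  rewrite -(cardID [pred t | (w t <= a)%N]).
  congr (_ + _)%N; apply: eq_card => t.
    by rewrite !inE; case: (leqP (w t) a) => [/leqW ->|]; rewrite ?andbT ?andbF.
  rewrite !inE [(_ <= a.+1)%N]leq_eqVlt ltnS.
  by case: eqP => [->|_]; rewrite ?ltnn //=; case: (_ <= _)%N.
move=> le_card [|a].
  have := le_card 0%N; congr (_ = _); apply: eq_card => t.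
    by rewrite !inE leqn0.
  by rewrite !inE leqn0.
by have := le_card a.+1; rewrite !split_card le_card => /addnI.
Qed.

Lemma pair_of_card_le {m} (x y x' y' : 'I_m -> nat) :
  (forall a c, #|[pred t | (x t <= a)%N && (y t <= c)%N]| =
               #|[pred t | (x' t <= a)%N && (y' t <= c)%N]|) ->
  forall t, exists2 u, x' u = x t & y' u = y t.
Proof.
move=> le_card t.
have x_card a c : #|[pred t | (y t <= c)%N && (x t == a)]| =
                  #|[pred t | (y' t <= c)%N && (x' t == a)]|.
  have := card_eq_of_card_le x x' _ _ (le_card ^~ c) a.
  by congr (_ = _); apply: eq_card => u; rewrite !inE andbC.
have := card_eq_of_card_le y y' _ _ (x_card (x t)) (y t).
rewrite (cardD1 t) !inE !eqxx => /esym/eqP.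
case: (pickP [pred u | (y' u == y t) && (x' u == x t)]) => [u | none].
  by move=> /andP[/eqP yu /eqP xu] _; exists u.
by rewrite (eq_card0 none).
Qed.

Lemma ord_threshold_inj {m} (r s : nat) : (r <= m)%N -> (s <= m)%N ->
  (forall t : 'I_m, (t < r)%N = (t < s)%N) -> r = s.
Proof.
move=> rm sm eq_lt; apply/eqP; rewrite eqn_leq.
apply/andP; split; rewrite leqNgt; apply/negP => lt.
  by have := eq_lt (Ordinal (leq_trans lt rm)); rewrite /= lt ltnn.
by have := eq_lt (Ordinal (leq_trans lt sm)); rewrite /= lt ltnn.
Qed.

Lemma increasing_eq {m} (z z' : 'I_m -> nat) :
  {homo z : t u / (t < u)%N} -> {homo z' : t u / (t < u)%N} ->
  (forall t, exists u, z' u = z t) -> (forall t, exists u, z u = z' t) ->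
  z =1 z'.
Proof.
move=> z_lt z'_lt zz' z'z.
have ord_sorted : sorted (relpre val ltn) (enum 'I_m).
  by rewrite -sorted_map val_enum_ord iota_ltn_sorted.
have /eq_in_map eq_z : map z (enum 'I_m) = map z' (enum 'I_m).
  apply: (irr_sorted_eq ltn_trans ltnn).
  - exact: homo_sorted z_lt _ ord_sorted.
  - exact: homo_sorted z'_lt _ ord_sorted.
  move=> a; apply/mapP/mapP => -[t _ ->].
    by have [u eu] := zz' t; exists u; rewrite ?mem_enum.
  by have [u eu] := z'z t; exists u; rewrite ?mem_enum.
by move=> t; apply: eq_z; rewrite mem_enum.
Qed.

(* Numbers the columns in the order prescribed by the normalization: first those
   with y > 0 by increasing y, then those with y = 0 by increasing x; values
   of y are at most n2. *)
Definition column_key (n2 x y : nat) : nat :=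
  if y == 0%N then (n2 + x)%N else y.

Lemma column_key_lt {n1 n2 m r s} {i : 'I_m -> 'I_n2} {j : 'I_m -> 'I_n1} :
  (r <= s)%N -> normalized r s i j ->
  {homo (fun t => column_key n2 (etop r j t) (ebot s i t)) : t u / (t < u)%N}.
Proof.
move=> le_rs [i_lt _ j_lt] t u lt_tu; rewrite /column_key /ebot /etop.
have [us | su] := ltnP u s.
  by rewrite (ltn_trans lt_tu us) /= ltnS i_lt ?lt_tu.
rewrite (leq_trans le_rs su) /=; have [ts | st] /= := ltnP t s.
  by rewrite addnS !ltnS (leq_trans (ltn_ord (i t))) ?leq_addr.
by rewrite (leq_trans le_rs st) ltn_add2l ltnS j_lt ?st.
Qed.

Lemma normalized_display_unique {F : fieldType} {n1 n2 m r s r' s'}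
    {i i' : 'I_m -> 'I_n2} {j j' : 'I_m -> 'I_n1} :
  (r <= s <= m)%N -> (r' <= s' <= m)%N ->
  normalized r s i j -> normalized r' s' i' j' ->
  (forall a c, \rank (lower_proj2 F a c *m display_mx F r s i j) =
               \rank (lower_proj2 F a c *m display_mx F r' s' i' j')) ->
  [/\ r = r', s = s',
      forall t : 'I_m, (t < s)%N -> i t = i' t
    & forall t : 'I_m, (r <= t)%N -> j t = j' t].
Proof.
move=> /andP[rs sm] /andP[rs' sm'] nrm nrm' eq_rank.
have card_le a c :
    #|[pred t | (etop r j t <= a)%N && (ebot s i t <= c)%N]| =
    #|[pred t | (etop r' j' t <= a)%N && (ebot s' i' t <= c)%N]|.
  have le_m (P : simpl_pred 'I_m) : (#|P| <= m)%N.
    by rewrite -[leqRHS]card_ord max_card.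
  have := eq_rank a c; rewrite !rank_lower_proj2_display // => eq_sub.
  by rewrite -[LHS](subKn (le_m _)) eq_sub subKn.
have pair := pair_of_card_le _ _ _ _ card_le.
have pair' := pair_of_card_le _ _ _ _ (fun a c => esym (card_le a c)).
pose key r s i j t := column_key n2 (@etop n1 m r j t) (@ebot n2 m s i t).
have eq_key : key r s i j =1 key r' s' i' j'.
  apply: increasing_eq => [||t|t]; try exact: column_key_lt.
    by have [u eq_x eq_y] := pair t; exists u; rewrite /key eq_x eq_y.
  by have [u eq_x eq_y] := pair' t; exists u; rewrite /key eq_x eq_y.
have eq_pair t : etop r j t = etop r' j' t /\ ebot s i t = ebot s' i' t.
  have [u eq_x eq_y] := pair t.
  suff eq_ut : u = t by rewrite -eq_x -eq_y eq_ut.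
  have eq_tu : key r' s' i' j' t = key r' s' i' j' u.
    by rewrite -eq_key /key eq_x eq_y.
  have lt_key : {homo key r' s' i' j' : t u / (t < u)%N}.
    exact: column_key_lt.
  apply: val_inj; have [/lt_key | /lt_key | //] := ltngtP u t.
    by rewrite eq_tu ltnn.
  by rewrite eq_tu ltnn.
have lt_s (t : 'I_m) : (t < s)%N = (t < s')%N.
  by have [_] := eq_pair t; rewrite /ebot; do 2!case: ifP.
have lt_r (t : 'I_m) : (t < r)%N = (t < r')%N.
  have [+ _] := eq_pair t.
  by rewrite /etop; case: (leqP r t); case: (leqP r' t).
split=> [|| t ts | t rt].
- apply: ord_threshold_inj lt_r; first exact: leq_trans sm.
  exact: leq_trans sm'.
- exact: ord_threshold_inj lt_s.
- have [_] := eq_pair t; rewrite /ebot -lt_s ts => -[eq_i].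
  exact: val_inj.
have [+ _] := eq_pair t; rewrite /etop rt leqNgt -lt_r -leqNgt rt => -[eq_j].
exact: val_inj.
Qed.

Theorem theoremB (R : realType) (m1 m2 n1 n2 : nat)
    (hm1 : (0 < m1)%N) (hm2 : (0 < m2)%N)
    (hn1 : (0 < n1)%N) (hn2 : (0 < n2)%N)
    (hn : (m1 + m2 = n1 + n2)%N)
    (O : set {vspace 'cV[R]_(n1 + n2)})
    (hO : is_orbit (@levi_borel R n1 n2) (@grassmannian R m1 (n1 + n2)) O) :
  (exists (r s : nat) (i : 'I_m1 -> 'I_n2) (j : 'I_m1 -> 'I_n1),
     (r <= s <= m1)%N /\ O (colspan (display_mx R r s i j)))
  /\
  (forall (r s r' s' : nat) (i i' : 'I_m1 -> 'I_n2) (j j' : 'I_m1 -> 'I_n1),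
     (r <= s <= m1)%N -> (r' <= s' <= m1)%N ->
     normalized r s i j -> normalized r' s' i' j' ->
     O (colspan (display_mx R r s i j)) ->
     O (colspan (display_mx R r' s' i' j')) ->
     [/\ r = r', s = s',
         forall t : 'I_m1, (t < s)%N -> i t = i' t
       & forall t : 'I_m1, (r <= t)%N -> j t = j' t]).
Proof.
case: hO => V grV ->; split; first exact: exists_display.
move=> r s r' s' i i' j j' le_rs le_rs' nrm nrm'.
rewrite (vbasis_colspan V) => orb orb'.
apply: (normalized_display_unique (F := R) le_rs le_rs' nrm nrm') => a c.
rewrite (rank_lower_proj2_orbit _ a c _ _ orb).
exact/esym/rank_lower_proj2_orbit.
Qed.
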